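(* Let $\mathcal M$ be a finitely branching countable MDP with initial state $s_0$, let $\{A_i\}_{i\in\mathbb N}$ be a sequence of sets of transitions of $\mathcal M$ that is monotone decreasing with respect to set inclusion, and consider the objective $\varphi=\bigcap_{i\in\mathbb N}\mathsf F\mathsf G A_i$. For every $\varepsilon>0$ there exists an $\varepsilon$-optimal memoryless deterministic (MD) strategy for $\varphi$ from $s_0$.
   Context: An MDP $\mathcal M$ consists of a countable set $S$ of states partitioned into controlled states $S_C$ and random states $S_R$; a transition relation $\longrightarrow\subseteq S\times S$ such that every state has at least one successor; and a function $P$ assigning to each random state $s$ a probability distribution on the set $\mathrm{Succ}(s)$ of successors of $s$. It is finitely branching if $\mathrm{Succ}(s)$ is finite for every state $s$ (controlled or random). A run is an infinite sequence $s_0e_0s_1e_1\cdots$ with $e_i=(s_i,s_{i+1})\in\longrightarrow$; a history is a finite prefix of a run ending in a controlled state. A (general) strategy $\sigma$ maps each history ending in $s$ to a probability distribution on $\mathrm{Succ}(s)$. It is deterministic if all these distributions are Dirac, and memoryless if they depend only on the current state. A strategy and a start state $s$ induce a probability measure $\mathcal P_{\mathcal M,s,\sigma}$ on the Borel $\sigma$-algebra of runs from $s$. For an event $\varphi$, $\mathrm{val}(s)=\sup_\sigma\mathcal P_{\mathcal M,s,\sigma}(\varphi)$ over all strategies; $\sigma$ is $\varepsilon$-optimal for $\varphi$ from $s$ if $\mathcal P_{\mathcal M,s,\sigma}(\varphi)\ge\mathrm{val}(s)-\varepsilon$. $\mathsf F\mathsf G A$ is the set of runs all but finitely many of whose transitions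 are in $A$. *)

(* Defs.v *)
From HB Require Import structures.
From mathcomp Require Import all_boot all_order all_algebra.
From mathcomp Require Import all_classical all_reals all_analysis.

Set Implicit Arguments.
Unset Strict Implicit.
Unset Printing Implicit Defensive.

Import Order.TTheory GRing.Theory Num.Theory.
Import numFieldNormedType.Exports.

Local Open Scope classical_set_scope.
Local Open Scope ring_scope.

Definition is_distr (R : realType) (T : choiceType) (A : set T) (p : T -> R) :=
  [/\ forall t, 0 <= p t, forall t, ~ A t -> p t = 0
    & (\esum_(t in A) (p t)%:E = 1)%E].

(* The random states are those that are not [controlled]; [prob] is irrelevant
   at controlled states. *)
Record mdp (R : realType) := MDP {
  state :> countType;
  controlled : pred state;
  trans : rel state;
  trans_total : forall s, exists t, trans s t;
  prob : state -> state -> R;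
  probP : forall s, ~~ controlled s -> is_distr [set t | trans s t] (prob s)
}.

Definition Succ (R : realType) (M : mdp R) (s : M) : set M :=
  [set t | trans s t].

Definition finitely_branching (R : realType) (M : mdp R) :=
  forall s : M, finite_set (Succ s).

Definition transitions (R : realType) (M : mdp R) : set (M * M) :=
  [set e | trans e.1 e.2].
Arguments transitions {R} M.

(* A run is determined by the states it visits. *)
Record run (R : realType) (M : mdp R) (s : M) := Run {
  visit :> nat -> M;
  visit0 : visit 0%N = s;
  visit_trans : forall n, trans (visit n) (visit n.+1)
}.

Definition edge (R : realType) (M : mdp R) (s : M) (r : run s) (n : nat)
  : M * M := (r n, r n.+1).

(* A history [s_0 e_0 s_1 ... e_(n-1) s_n] is encoded by its first state
   [x = s_0] and the sequence [p = [:: s_1; ...; s_n]] of the next ones. *)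
Definition is_history (R : realType) (M : mdp R) (x : M) (p : seq M) : bool :=
  path (@trans _ M) x p && controlled (last x p).

(* The values of a strategy outside histories are irrelevant. *)
Record strategy (R : realType) (M : mdp R) := Strategy {
  choice_of :> M -> seq M -> M -> R;
  choiceP : forall x p, is_history x p ->
    is_distr (Succ (last x p)) (choice_of x p)
}.

Definition deterministic (R : realType) (M : mdp R) (sigma : strategy M) :=
  forall x p, is_history x p ->
    exists t : M, forall u, sigma x p u = (u == t)%:R.

Definition memoryless (R : realType) (M : mdp R) (sigma : strategy M) :=
  forall x p y q, is_history x p -> is_history y q -> last x p = last y q ->
    sigma x p = sigma y q.

Section Runs.
Variables (R : realType) (M : mdp R) (s : M).

HB.instance Definition _ := gen_eqMixin (run s).
HB.instance Definition _ := gen_choiceMixin (run s).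

Lemma run_inhabited : $|run s|.
Proof.
have [f fP] := choice (@trans_total _ M).
by apply/squash; exists (fun n => iter n f s) => // n /=; exact: fP.
Qed.

HB.instance Definition _ := isPointed.Build (run s) (unsquash run_inhabited).

Definition prefix_of (r : run s) (n : nat) : seq M := mkseq (fun i => r i.+1) n.

Definition cylinder (p : seq M) : set (run s) :=
  [set r | prefix_of r (size p) = p].

End Runs.
Arguments prefix_of {R M s} r n.
Arguments cylinder {R M} s p.

(* The cylinders form a countable base of the topology that the set of runs
   inherits from the product of the discrete topologies, so the sigma-algebra
   they generate is the Borel one. *)
Definition run_space (R : realType) (M : mdp R) (s : M) :=
  g_sigma_algebraType (range (cylinder s)).

Definition step (R : realType) (M : mdp R) (sigma : strategy M)
    (x : M) (p : seq M) : M -> R :=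
  if controlled (last x p) then sigma x p else prob (last x p).

Definition cylinder_prob (R : realType) (M : mdp R) (sigma : strategy M)
    (s : M) (p : seq M) : R :=
  \prod_(i < size p) step sigma s (take i p) (nth s p i).

Definition induced (R : realType) (M : mdp R) (sigma : strategy M) (s : M)
    (P : probability (run_space s) R) :=
  forall p, P (cylinder s p) = (cylinder_prob sigma s p)%:E.

Section InducedUnique.
Variables (R : realType) (M : mdp R) (sigma : strategy M) (s : M).

Lemma prefix_ofS (r : run s) n :
  prefix_of r n.+1 = rcons (prefix_of r n) (r n.+1).
Proof. exact: mkseqS. Qed.

Lemma take_prefix_of (r : run s) n m : (n <= m)%N ->
  take n (prefix_of r m) = prefix_of r n.
Proof.
by move=> nm; rewrite /prefix_of /mkseq -map_take take_iota (minn_idPl nm).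
Qed.

Lemma cylinder0 : cylinder s [::] = setT.
Proof. by apply/seteqP; split. Qed.

Lemma cylinderI p q : (size p <= size q)%N ->
  cylinder s p `&` cylinder s q = cylinder s q \/
  cylinder s p `&` cylinder s q = set0.
Proof.
move=> pq; have [e|ne] := eqVneq (take (size p) q) p; [left|right].
  apply/seteqP; split => [r []//|r rq]; split => //.
  by rewrite /cylinder/= -(take_prefix_of _ pq) rq.
apply/seteqP; split => // r [rp rq]; move/eqP: ne; apply.
by rewrite -[in LHS]rq take_prefix_of.
Qed.

Lemma induced_unique (P Q : probability (run_space s) R) :
  induced sigma P -> induced sigma Q ->
  forall A : set (run_space s), measurable A -> P A = Q A.
Proof.
move=> HP HQ A mA.
pose G := range (cylinder s) `|` [set set0].
have GE : @measurable _ (run_space s) = <<s G >>.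
  apply/seteqP; split; first by apply: sub_sigma_algebra2 => B BC; left.
  apply: smallest_sub; first exact: sigma_algebra_measurable.
  move=> B [BC|->]; first exact: sub_sigma_algebra.
  exact: (@measurable0 _ (run_space s)).
apply: (@measure_unique _ _ (run_space s) G (fun=> setT)) => //.
- move=> B C [[p _ <-]|->] [[q _ <-]|->]; rewrite ?setI0 ?set0I; try by right.
  have [pq|/ltnW qp] := leqP (size p) (size q).
    by have [->|->] := cylinderI pq; [left; exists q|right].
  by rewrite setIC; have [->|->] := cylinderI qp; [left; exists p|right].
- by move=> _; left; exists [::] => //; exact: cylinder0.
- by rewrite bigcup_const.
- move=> B [[p _ <-]|->]; first exact: (etrans (HP p) (esym (HQ p))).
  by rewrite !measure0.
- by move=> _; rewrite [X in (X < _)%E](probability_setT P) ltry.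
Qed.

End InducedUnique.

Section ImageProbability.
Variables (R : realType) (d : measure_display) (T : measurableType d).
Variable X : R -> T.
Hypothesis mX : forall B : set T, measurable B ->
  measurable (`[0, 1[%classic `&` (X @^-1` B) : set (measurableTypeR R)).

Let mu (B : set T) : \bar R :=
  lebesgue_measure (`[0, 1[%classic `&` (X @^-1` B)).

Let mu0 : mu set0 = 0%E.
Proof. by rewrite /mu preimage_set0 setI0 measure0. Qed.

Let mu_ge0 B : (0 <= mu B)%E.
Proof. exact: measure_ge0. Qed.

Let mu_sigma_additive : semi_sigma_additive mu.
Proof.
move=> F mF tF mUF; rewrite /mu preimage_bigcup setI_bigcupr.
apply: measure_semi_sigma_additive => //.
- by move=> i; exact: mX.
- apply/trivIsetP => i j _ _ ij.
  move/trivIsetP : tF => /(_ i j I I ij) e.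
  by rewrite setIACA setIid -preimage_setI e preimage_set0 setI0.
- by rewrite -setI_bigcupr -preimage_bigcup; exact: mX.
Qed.

HB.instance Definition _ := isMeasure.Build _ _ _ mu
  mu0 mu_ge0 mu_sigma_additive.

Let mu1 : mu setT = 1%E.
Proof.
rewrite /mu preimage_setT setIT lebesgue_measure_itv/= lte_fin ltr01.
by rewrite sube0.
Qed.

HB.instance Definition _ := Measure_isProbability.Build _ _ _ mu mu1.

Lemma image_probability : exists P : probability T R, forall B,
  P B = lebesgue_measure (`[0, 1[%classic `&` (X @^-1` B)).
Proof. by exists mu. Qed.

End ImageProbability.

(* Existence: split [0, 1[ into consecutive half-open intervals whose lengths
   are the cylinder probabilities; the induced probability is the image of the
   Lebesgue measure under the map sending a point to the run whose prefixes it
   belongs to. *)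
Section InducedExists.
Variables (R : realType) (M : mdp R) (sigma : strategy M) (s : M).
Local Notation st := (step sigma s).

Lemma stepP p : path (@trans _ M) s p -> is_distr (Succ (last s p)) (st p).
Proof.
move=> sp; rewrite /step; case: ifPn => [c|/probP//].
by apply: choiceP; rewrite /is_history sp.
Qed.

Definition wt (p : seq M) (k : nat) : R :=
  if @pickle_inv M k is Some t then st p t else 0.

Definition off p n : R := \sum_(k < n) wt p k.

Lemma wt_ge0 p k : path (@trans _ M) s p -> 0 <= wt p k.
Proof. by move=> /stepP[h _ _]; rewrite /wt; case: pickle_inv. Qed.

Lemma wt_pickle p t : wt p (pickle t) = st p t.
Proof. by rewrite /wt pickleK_inv. Qed.

Lemma offS p n : off p n.+1 = off p n + wt p n.
Proof. by rewrite /off big_ord_recr. Qed.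

Lemma off_le p m n : path (@trans _ M) s p -> (m <= n)%N -> off p m <= off p n.
Proof.
move=> sp; elim: n => [|n IH]; first by rewrite leqn0 => /eqP->.
rewrite leq_eqVlt => /orP[/eqP->//|]; rewrite ltnS => /IH h.
by rewrite offS (le_trans h)// lerDl wt_ge0.
Qed.

Lemma off_exceeds p v : path (@trans _ M) s p -> v < 1 -> exists n, v < off p n.
Proof.
move=> sp v1; have [h0 hA h1] := stepP sp.
apply: contrapT => /forallNP h.
suff : (1 <= v%:E)%E by rewrite lee_fin leNgt v1.
rewrite -h1; apply: ge_ereal_sup => _ [X [finX XA] <-].
pose l : seq M := finmap.enum_fset (fset_set X).
pose N := (\max_(t <- l) pickle t).+1%N.
have hN : off p N <= v by rewrite leNgt; apply/negP/h.
rewrite fsbig_finite//= -/l sumEFin lee_fin (le_trans _ hN)//.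
rewrite /off (_ : \sum_(t <- l) st p t =
   \sum_(k <- [seq pickle t | t <- l]) wt p k); last first.
  by rewrite big_map; apply: eq_bigr => t _; rewrite wt_pickle.
rewrite -(big_mkord predT (wt p)) /=.
have u : uniq [seq pickle t | t <- l].
  by rewrite map_inj_uniq ?finmap.fset_uniq//; exact: (pcan_inj pickleK).
rewrite [leRHS](bigID (mem [seq pickle t | t <- l]))/=.
rewrite -[in leRHS]big_filter.
rewrite (perm_big [seq x <- index_iota 0 N | x \in [seq pickle t | t <- l]]).
  by rewrite lerDl sumr_ge0// => k _; exact: wt_ge0.
apply: uniq_perm => //; first by rewrite filter_uniq ?iota_uniq.
move=> k; rewrite mem_filter mem_index_iota/=.
apply/idP/idP => [kX|/andP[]//]; rewrite kX/=.
by case/mapP: kX => t tX ->; rewrite ltnS leq_bigmax_seq.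
Qed.

(* the interval of [p], given by its left end and its length, read from the
   reversed sequence *)
Fixpoint itv_rev (q : seq M) : R * R :=
  if q is t :: q' then
    let: (a, w) := itv_rev q' in
    (a + w * off (rev q') (pickle t), w * st (rev q') t)
  else (0, 1).

Definition lft p := (itv_rev (rev p)).1.
Definition len p := (itv_rev (rev p)).2.
Definition J p : set R := [set u | lft p <= u < lft p + len p].

Lemma lft_rcons p t : lft (rcons p t) = lft p + len p * off p (pickle t).
Proof. by rewrite /lft /len rev_rcons/=; case: itv_rev => a w/=; rewrite revK. Qed.

Lemma len_rcons p t : len (rcons p t) = len p * st p t.
Proof. by rewrite /len rev_rcons/=; case: itv_rev => a w/=; rewrite revK. Qed.

Lemma lenE p : len p = cylinder_prob sigma s p.
Proof.
elim/last_ind: p => [|p t IH]; first by rewrite /cylinder_prob big_ord0.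
rewrite len_rcons IH /cylinder_prob size_rcons big_ord_recr/=.
rewrite nth_rcons ltnn eqxx -cats1 take_size_cat//; congr (_ * _).
by apply: eq_bigr => i _; rewrite nth_cat ltn_ord takel_cat// ltnW.
Qed.

Lemma J_len_gt0 p u : J p u -> 0 < len p.
Proof. by move=> /andP[a b]; have := le_lt_trans a b; rewrite ltrDl. Qed.

Lemma J_rconsE p t u : 0 < len p ->
  J (rcons p t) u <->
  off p (pickle t) <= (u - lft p) / len p < off p (pickle t).+1.
Proof.
move=> l0; rewrite /J/= lft_rcons len_rcons offS wt_pickle -addrA -mulrDr.
by rewrite ler_pdivlMr// ltr_pdivrMr// lerBrDl ltrBlDl ![_ * len p]mulrC.
Qed.

Lemma J_next p u : path (@trans _ M) s p -> J p u -> exists t,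
  J (rcons p t) u /\ path (@trans _ M) s (rcons p t).
Proof.
move=> sp Jp; have l0 := J_len_gt0 Jp.
pose v := (u - lft p) / len p.
have v1 : v < 1.
  by case/andP: Jp => _; rewrite /v ltr_pdivrMr// mul1r ltrBlDl.
have v0 : 0 <= v by case/andP: Jp => h _; rewrite divr_ge0 ?subr_ge0// ltW.
case: (ex_minnP (off_exceeds sp v1)) => -[|n]; first by rewrite /off big_ord0 ltNge v0.
move=> vn hmin.
have nv : off p n <= v by rewrite leNgt; apply/negP => /hmin; rewrite ltnn.
have wn : 0 < wt p n by have := le_lt_trans nv vn; rewrite offS ltrDl.
have [t tn] : exists t : M, pickle t = n.
  move: wn; rewrite /wt; have := @pickle_invK M n.
  by case: pickle_inv => [t /= <-|]; [exists t|rewrite ltxx].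
exists t; split; first by apply/J_rconsE => //; rewrite tn; apply/andP.
rewrite rcons_path sp/=; apply: contrapT => nt.
have [_ hA _] := stepP sp.
by move: wn; rewrite -tn wt_pickle hA// ltxx.
Qed.

Lemma off_le1 p n : path (@trans _ M) s p -> off p n <= 1.
Proof.
move=> sp; have [g0 gA g1] := stepP sp.
pose X := [seq t <- pmap (@pickle_inv M) (iota 0 n) | trans (last s p) t].
have uX : uniq X.
  rewrite filter_uniq// (@pmap_uniq _ _ _ pickle) ?iota_uniq//.
  exact: pickle_invK.
rewrite -lee_fin -g1; apply: esum_ge; exists [set` X].
  split; first exact: finite_seq.
  by move=> t /=; rewrite mem_filter => /andP[].
rewrite -fsbig_seq// sumEFin lee_fin /X big_filter /off.
rewrite -(big_mkord predT (wt p)) /= /index_iota subn0.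
rewrite le_eqVlt; apply/orP; left; apply/eqP.
elim: (iota 0 n) => [|k l IH]/=; first by rewrite !big_nil.
rewrite big_cons IH /wt /oapp; case: pickle_inv => [t|]; last by rewrite add0r.
rewrite big_cons; case: ifPn => // nt.
by rewrite gA ?add0r//; exact/negP.
Qed.

Lemma J_sub p t u : path (@trans _ M) s p -> 0 < len p ->
  J (rcons p t) u -> J p u.
Proof.
move=> sp l0 /J_rconsE => /(_ l0) /andP[h1 h2].
have v0 : 0 <= (u - lft p) / len p.
  by apply: le_trans h1; apply: sumr_ge0 => k _; exact: wt_ge0.
have v1 := lt_le_trans h2 (off_le1 (pickle t).+1 sp).
move: v0 v1; rewrite pmulr_lge0 ?invr_gt0// subr_ge0 ltr_pdivrMr// mul1r.
by rewrite ltrBlDl /J/= => -> ->.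
Qed.

Lemma J_uniq p t t' u : path (@trans _ M) s p -> 0 < len p ->
  J (rcons p t) u -> J (rcons p t') u -> t = t'.
Proof.
move=> sp l0 /J_rconsE => /(_ l0) /andP[h1 h2].
move=> /J_rconsE => /(_ l0) /andP[h1' h2'].
apply: (pcan_inj pickleK); apply/eqP; rewrite eqn_leq; apply/andP; split.
- rewrite leqNgt; apply/negP => /(off_le sp) h.
  by have := le_lt_trans (le_trans h h1) h2'; rewrite ltxx.
- rewrite leqNgt; apply/negP => /(off_le sp) h.
  by have := le_lt_trans (le_trans h h1') h2; rewrite ltxx.
Qed.

Lemma len_path p : (path (@trans _ M) s p /\ 0 <= len p) \/ len p = 0.
Proof.
elim/last_ind: p => [|p t [[sp l0]|l0]]; first by left; rewrite /len/= ler01.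
- have [g0 gA _] := stepP sp; rewrite len_rcons rcons_path sp/=.
  have [tr|ntr] := boolP (trans (last s p) t); [left|right].
    by rewrite mulr_ge0.
  by rewrite gA ?mulr0//; exact/negP.
- by right; rewrite len_rcons l0 mul0r.
Qed.

Lemma J_path p u : J p u -> path (@trans _ M) s p.
Proof.
move=> /J_len_gt0 l0; have [[]//|l] := len_path p.
by move: l0; rewrite l ltxx.
Qed.

Lemma J_rcons_sub p t u : J (rcons p t) u -> J p u.
Proof.
move=> Jt; have := J_path Jt; rewrite rcons_path => /andP[sp _].
apply: (J_sub sp _ Jt); have := J_len_gt0 Jt; rewrite len_rcons.
have [[_]|->] := len_path p; last by rewrite mul0r ltxx.
by rewrite le_eqVlt => /orP[/eqP<-|//]; rewrite mul0r ltxx.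
Qed.

Lemma J_nilE : J [::] = `[0, 1[%classic.
Proof.
by apply/seteqP; split => u; rewrite /J /lft /len/= in_itv/= add0r.
Qed.

Lemma J_itvE p : J p = `[lft p, lft p + len p[%classic.
Proof. by apply/seteqP; split => u; rewrite /J/= in_itv. Qed.

Lemma J_run u : `[0, 1[%classic u ->
  exists r : run s, forall p, J p u <-> cylinder s p r.
Proof.
rewrite -J_nilE => u01.
have /choice[f fP] : forall p, exists t, J p u -> J (rcons p t) u.
  move=> p; have [Jp|nJp] := pselect (J p u); last by exists s.
  by have [t [Jt _]] := J_next (J_path Jp) Jp; exists t.
pose F n := iter n (fun p => rcons p (f p)) [::].
have JF n : J (F n) u by elim: n => [//|n IH]; exact: fP.
have FT n : trans (last s (F n)) (last s (F n.+1)).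
  by have := J_path (JF n.+1); rewrite /= rcons_path last_rcons => /andP[].
pose r : run s := Run (visit := fun n => last s (F n)) erefl FT.
have rF n : prefix_of r n = F n.
  by elim: n => [//|n IH]; rewrite prefix_ofS IH /= last_rcons.
exists r => p; rewrite /cylinder/= rF; split => [|<-]; last exact: JF.
elim/last_ind: p => [//|p t IH] Jt; rewrite size_rcons/=.
have Jp := J_rcons_sub Jt; have := fP _ Jp; rewrite (IH Jp) => Jf.
by congr rcons; exact: J_uniq (J_path Jp) (J_len_gt0 Jp) Jf Jt.
Qed.

Lemma induced_exists : exists P : probability (run_space s) R, induced sigma P.
Proof.
have /choice[X XP] : forall u : R, exists r : run s,
    `[0, 1[%classic u -> forall p, J p u <-> cylinder s p r.
  move=> u; have [u01|nu] := pselect (`[0, 1[%classic u).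
    by have [r rP] := J_run u01; exists r.
  by exists point.
have mD : measurable (`[0, 1[%classic : set (measurableTypeR R)).
  exact: measurable_itv.
have XJ p : `[0, 1[%classic `&` (X @^-1` cylinder s p) = J p.
  apply/seteqP; split => u.
    by case=> u01 Xu; apply/(XP _ u01).
  move=> Ju; have u01 : `[0, 1[%classic u.
    rewrite -J_nilE; elim/last_ind: p Ju => [//|p t IH] Jt.
    exact/IH/(J_rcons_sub Jt).
  by split => //; exact/(XP _ u01).
have mX (B : set (run_space s)) : measurable B ->
    measurable (`[0, 1[%classic `&` (X @^-1` B) : set (measurableTypeR R)).
  apply: (@measurability _ _ (measurableTypeR R) (run_space s) _ X
    (range (cylinder s))) => // _ [_ [p _ <-] <-].
  by rewrite XJ J_itvE; exact: measurable_itv.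
have [P PE] := image_probability mX.
exists P => p; rewrite PE XJ J_itvE lebesgue_measure_itv/= lte_fin -lenE.
have l0 : 0 <= len p by have [[]//|->] := len_path p.
rewrite -EFinD addrAC subrr add0r; case: ifPn => //.
by rewrite ltrDl -leNgt => h; congr EFin; apply/le_anti; rewrite l0 h.
Qed.

End InducedExists.

Definition run_prob (R : realType) (M : mdp R) (sigma : strategy M) (s : M)
  : probability (run_space s) R := sval (cid (induced_exists sigma s)).

Lemma run_probP (R : realType) (M : mdp R) (sigma : strategy M) (s : M) :
  induced sigma (run_prob sigma s).
Proof. exact: svalP. Qed.

(* Meaningful for measurable [phi]. *)
Definition value (R : realType) (M : mdp R) (s : M) (phi : set (run s))
  : \bar R := ereal_sup [set run_prob sigma s phi | sigma in setT].

Definition eps_optimal (R : realType) (M : mdp R) (s : M) (phi : set (run s))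
    (eps : R) (sigma : strategy M) :=
  (value phi - eps%:E <= run_prob sigma s phi)%E.

Definition FG (R : realType) (M : mdp R) (s : M) (A : set (M * M))
  : set (run s) := [set r | \forall n \near \oo, A (edge r n)].
Arguments FG {R M} s A.

(* Main.v *)
(* Fix a strategy [sigma] that is nearly optimal for [phi].  There are times
   [k i] such that, up to a small probability, a run of [sigma] in [phi] only
   takes edges of [A i] from time [k i] on.  Give the edge [e] the cost
   [eta / 2 ^ K i], where [i] is the first index with [e] outside [A i] and
   [K i = k 0 + ... + k i], and no cost if there is no such [i].  A run with
   finite total cost is then in [phi], whereas a run of [sigma] in [phi] pays
   at most [eta] with high probability.  Consider the problem of minimizing the
   expected total cost when giving up is allowed at any time for a cost of [1].
   Its value [mincost] is the limit of value iteration, because branching is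
   finite, and [sigma], giving up as soon as it misses a time [k i], shows that
   it is at most [1 - P(phi) + O(eta)].  Conversely, let an MD strategy always
   move to a successor minimizing edge cost plus [mincost].  The cost paid so
   far plus [mincost] of the current state is a supermartingale as long as it
   stays below [1], so it reaches [1] with probability at most [mincost] of the
   initial state; if it never does, the total cost is finite. *)

Require Import Defs.
From mathcomp Require Import all_boot all_order all_algebra.
From mathcomp Require Import all_classical all_reals all_analysis.
From mathcomp Require Import lra.

Set Implicit Arguments.
Unset Strict Implicit.
Unset Printing Implicit Defensive.

Import Order.TTheory GRing.Theory Num.Theory.
Import numFieldNormedType.Exports.

Local Open Scope classical_set_scope.
Local Open Scope ring_scope.

Section FiniteBranching.
Variables (R : realType) (M : mdp R).
Hypothesis fb : finitely_branching M.

Definition succs (s : M) : seq M := finmap.enum_fset (fset_set (Succ s)).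

Lemma succs_uniq s : uniq (succs s).
Proof. exact: finmap.fset_uniq. Qed.

Lemma mem_succs s t : (t \in succs s) = trans s t.
Proof. by rewrite /succs in_fset_set ?mem_setE//; apply/idP/idP; rewrite inE. Qed.

Lemma sum_distr s (d : M -> R) : is_distr (Succ s) d ->
  \sum_(t <- succs s) d t = 1.
Proof.
move=> [d0 _ d1]; apply: EFin_inj; rewrite -d1 esum_fset//.
  by rewrite fsbig_finite//= sumEFin.
by move=> t _; rewrite lee_fin.
Qed.

Lemma sum_distr_cst s (d : M -> R) a : is_distr (Succ s) d ->
  \sum_(t <- succs s) d t * a = a.
Proof. by move=> /sum_distr d1; rewrite -mulr_suml d1 mul1r. Qed.

(** * Expectations over the paths of a fixed length *)

Section Expectation.
Variables (sigma : strategy M) (s : M).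
Local Notation st := (step sigma s).
Local Notation w := (cylinder_prob sigma s).

Fixpoint paths (n : nat) : seq (seq M) :=
  if n is m.+1 then [seq rcons p t | p <- paths m, t <- succs (last s p)]
  else [:: [::]].

Lemma mem_paths n p : (p \in paths n) = (size p == n) && path (@trans _ M) s p.
Proof.
elim: n p => [|n IH] p; first by rewrite inE; case: p.
apply/allpairsPdep/idP => [[q [t [+ + ->]]]|].
  by rewrite IH mem_succs size_rcons eqSS rcons_path => /andP[-> ->].
case/lastP: p => // q t; rewrite size_rcons eqSS rcons_path andbA => /andP[qn lt].
by exists q, t; rewrite IH qn mem_succs.
Qed.

Lemma paths_uniq n : uniq (paths n).
Proof.
elim: n => [//|n IH]; apply: allpairs_uniq_dep => //.
  by move=> p _; exact: succs_uniq.
by move=> [p t] [q u] _ _ /= /rcons_inj[-> ->].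
Qed.

(** The mean of [f] at the length [n] prefix of a random run; it is a finite sum because branching
    is finite. *)
Definition expect (n : nat) (f : seq M -> R) : R :=
  \sum_(p <- paths n) w p * f p.

Lemma cylinder_prob_rcons p t : w (rcons p t) = w p * st p t.
Proof.
rewrite /cylinder_prob size_rcons big_ord_recr/=.
rewrite nth_rcons ltnn eqxx -cats1 take_size_cat//; congr (_ * _).
by apply: eq_bigr => i _; rewrite nth_cat ltn_ord takel_cat// ltnW.
Qed.

Lemma cylinder_prob_ge0 p : path (@trans _ M) s p -> 0 <= w p.
Proof.
elim/last_ind: p => [_|p t IH]; first by rewrite /cylinder_prob big_ord0.
rewrite rcons_path => /andP[sp _]; rewrite cylinder_prob_rcons mulr_ge0//.
  exact: IH.
by have [] := stepP sigma sp.
Qed.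

Lemma expect0 f : expect 0 f = f [::].
Proof. by rewrite /expect big_seq1 /cylinder_prob big_ord0 mul1r. Qed.

Lemma expectS n f : expect n.+1 f =
  expect n (fun p => \sum_(t <- succs (last s p)) st p t * f (rcons p t)).
Proof.
rewrite /expect/= big_allpairs_dep; apply: eq_bigr => p _.
by rewrite mulr_sumr; apply: eq_bigr => t _; rewrite cylinder_prob_rcons mulrA.
Qed.

Lemma ler_expect n f g :
  (forall p, path (@trans _ M) s p -> size p = n -> f p <= g p) ->
  expect n f <= expect n g.
Proof.
move=> fg; rewrite /expect !big_seq; apply: ler_sum => p.
rewrite mem_paths => /andP[/eqP pn sp].
by rewrite ler_wpM2l ?cylinder_prob_ge0 ?fg.
Qed.

Lemma expect_supermartingale (f : seq M -> R) :
  (forall p, path (@trans _ M) s p ->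
    \sum_(t <- succs (last s p)) st p t * f (rcons p t) <= f p) ->
  forall n, expect n f <= f [::].
Proof.
move=> sub; elim=> [|n IH]; first by rewrite expect0.
by rewrite expectS (le_trans _ IH)//; apply: ler_expect => p sp _; exact: sub.
Qed.

(** The index of [f] counts the steps left, so it drops by one whenever the history grows by one;
    [valit] will enter in this way. *)
Lemma expect_submartingale (f : nat -> seq M -> R) :
  (forall m p, path (@trans _ M) s p ->
    f m.+1 p <= \sum_(t <- succs (last s p)) st p t * f m (rcons p t)) ->
  forall n, f n [::] <= expect n (f 0%N).
Proof.
move=> sub n; rewrite -[n in f n](addn0 n).
elim: n (0%N) => [|n IH] m; first by rewrite expect0.
rewrite expectS addSnnS (le_trans (IH m.+1))//.
by apply: ler_expect => p sp _; exact: sub.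
Qed.

Lemma prefix_of_path (r : run s) n : path (@trans _ M) s (prefix_of r n).
Proof.
suff h m : path (@trans _ M) (r m) (map (fun i => r i.+1) (iota m n)).
  by rewrite -[s in path _ s](visit0 r); exact: h.
by elim: n m => [//|n IH] m /=; rewrite visit_trans IH.
Qed.

Let prefix_eventE n (Q : pred (seq M)) : [set r | Q (prefix_of r n)] =
  \bigcup_(p in [set` [seq p <- paths n | Q p]]) cylinder s p.
Proof.
apply/seteqP; split => r /=.
  move=> Qr; exists (prefix_of r n); last by rewrite /cylinder/= size_mkseq.
  by rewrite /= mem_filter Qr mem_paths size_mkseq eqxx prefix_of_path.
move=> [p /=]; rewrite mem_filter mem_paths => /andP[Qp /andP[/eqP<- _]].
by rewrite /cylinder/= => ->.
Qed.

Let measurable_cylinder p : measurable (cylinder s p : set (run_space s)).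
Proof. by apply: sub_sigma_algebra; exists p. Qed.

Lemma measurable_prefix n (Q : pred (seq M)) :
  measurable ([set r | Q (prefix_of r n)] : set (run_space s)).
Proof.
rewrite prefix_eventE; apply: fin_bigcup_measurable => [|p _].
  exact: finite_seq.
exact: measurable_cylinder.
Qed.

(** Distinct paths of one length have disjoint cylinders, so the measure of the event is a finite
    sum. *)
Lemma run_prob_prefix n (Q : pred (seq M)) :
  run_prob sigma s [set r | Q (prefix_of r n)] =
  (expect n (fun p => (Q p)%:R))%:E.
Proof.
rewrite prefix_eventE measure_fin_bigcup//=.
- rewrite -fsbig_seq ?filter_uniq ?paths_uniq// big_filter /expect -sumEFin.
  rewrite big_mkcond; apply: eq_bigr => p _; rewrite run_probP.
  by case: (Q p); rewrite ?mulr1 ?mulr0.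
- move=> p q /=; rewrite !mem_filter !mem_paths.
  move=> /andP[_ /andP[/eqP pn _]] /andP[_ /andP[/eqP qn _]].
  by move=> [r []]; rewrite /cylinder/= pn qn => -> ->.
Qed.

Lemma expect_cst n a : expect n (fun=> a) = a.
Proof.
have e1 : expect n (fun=> 1) = 1.
  apply: EFin_inj; rewrite -(@probability_setT _ _ _ (run_prob sigma s)).
  by rewrite -(run_prob_prefix n xpredT); congr (run_prob _ _ _); exact/seteqP.
rewrite -[RHS]mul1r -e1 /expect mulr_suml; apply: eq_bigr => p _.
by rewrite mulr1.
Qed.

Lemma expectD n f g : expect n (fun p => f p + g p) = expect n f + expect n g.
Proof. by rewrite /expect -big_split/=; apply: eq_bigr => p _; rewrite mulrDr. Qed.

End Expectation.

(** * Value iteration for the total cost with the option of giving up *)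

Section ValueIteration.
Variable c : M -> M -> R.
Hypothesis c_ge0 : forall s t, 0 <= c s t.

(** The constant [1] in both minima is the price of giving up. *)
Definition bellman (V : M -> R) (s : M) : R :=
  if controlled s then \big[Num.min/1]_(t <- succs s) (c s t + V t)
  else Num.min 1 (\sum_(t <- succs s) prob s t * (c s t + V t)).

Definition valit (n : nat) : M -> R := iter n bellman (fun=> 0).

Lemma prob_ge0 (s t : M) : ~~ controlled s -> 0 <= prob s t.
Proof. by move=> /probP[]. Qed.

Lemma bellman_ge0 (V : M -> R) s : (forall t, 0 <= V t) -> 0 <= bellman V s.
Proof.
move=> V0; rewrite /bellman; case: ifPn => cs.
  by apply: le_bigmin => // t _; rewrite addr_ge0.
rewrite le_min ler01/= sumr_ge0// => t _.
by rewrite mulr_ge0 ?addr_ge0 ?prob_ge0.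
Qed.

Lemma bellman_le1 (V : M -> R) s : bellman V s <= 1.
Proof.
rewrite /bellman; case: ifPn => cs; first exact: bigmin_le_id.
by rewrite ge_min lexx.
Qed.

Lemma le_bellman (V W : M -> R) s : (forall t, V t <= W t) ->
  bellman V s <= bellman W s.
Proof.
move=> VW; rewrite /bellman; case: ifPn => cs.
  rewrite [leRHS]big_seq; apply: le_bigmin => [|t ts]; first exact: bigmin_le_id.
  by apply: bigmin_inf_seq ts _ _ => //; rewrite lerD2l.
rewrite le_min2//; apply: ler_sum => t _.
by rewrite ler_wpM2l ?prob_ge0// lerD2l.
Qed.

Lemma valit_ge0 n s : 0 <= valit n s.
Proof. by elim: n s => [//|n IH] s; exact: bellman_ge0. Qed.

Lemma valit_le1 n s : valit n s <= 1.
Proof. by case: n => [|n]; [exact: ler01|exact: bellman_le1]. Qed.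

Lemma valitS n s : valit n s <= valit n.+1 s.
Proof.
elim: n s => [|n IH] s; first exact: valit_ge0.
exact: (le_bellman _ IH).
Qed.

Lemma valit_nondecreasing s : nondecreasing_seq (valit^~ s).
Proof. by apply/nondecreasing_seqP => n; exact: valitS. Qed.

(** At a controlled state an average over the successors is at least the minimum; at a random state,
    dropping the option of giving up can only raise the cost. *)
Lemma valitS_le_step (sigma : strategy M) s p n :
  path (@trans _ M) s p ->
  valit n.+1 (last s p) <= \sum_(t <- succs (last s p))
    step sigma s p t * (c (last s p) t + valit n t).
Proof.
move=> sp; have dp := stepP sigma sp; set x := last s p.
rewrite /= /bellman; case: ifPn => cx; last first.
  by rewrite /step -/x (negbTE cx) ge_min lexx orbT.
rewrite -[leLHS](sum_distr_cst _ dp) !big_seq.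
apply: ler_sum => t xt; have [d0 _ _] := dp.
by rewrite ler_wpM2l// ge_bigmin_seq.
Qed.

Definition mincost (s : M) : R := limn (valit^~ s).

Let valit_ub s : has_ubound (range (valit^~ s)).
Proof. by exists 1 => _ [n _ <-]; exact: valit_le1. Qed.

Lemma cvg_valit s : valit n s @[n --> \oo] --> mincost s.
Proof.
by have /cvgP := nondecreasing_cvgn (valit_nondecreasing s) (valit_ub s).
Qed.

Lemma valit_le_mincost n s : valit n s <= mincost s.
Proof.
by apply: nondecreasing_cvgn_le (valit_nondecreasing s) _ _; exact: cvg_valit.
Qed.

Lemma mincost_ge0 s : 0 <= mincost s.
Proof. exact: le_trans (valit_ge0 0 s) (valit_le_mincost 0 s). Qed.

Lemma mincost_le s x : (forall n, valit n s <= x) -> mincost s <= x.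
Proof. by move=> h; apply: limr_le; [exact: cvg_valit|exact: nearW]. Qed.

(** As [valit] stays below [1] here, its minimum is attained by the sum, and a finite sum commutes
    with the limit. *)
Lemma mincost_random s : ~~ controlled s -> mincost s < 1 ->
  \sum_(t <- succs s) prob s t * (c s t + mincost t) <= mincost s.
Proof.
move=> cs s1.
have h : (\sum_(t <- succs s) prob s t * (c s t + valit n t)) @[n --> \oo] -->
    \sum_(t <- succs s) prob s t * (c s t + mincost t).
  apply: cvg_big => [|t _]; first by apply: add_continuous.
  by apply: cvgM; [exact: cvg_cst|apply: cvgD; [exact: cvg_cst|exact: cvg_valit]].
rewrite -(cvg_lim _ h)//; apply: limr_le; first exact: cvgP h.
apply: nearW => n; have := valit_le_mincost n.+1 s.
by rewrite /= /bellman (negbTE cs) ge_min leNgt s1.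
Qed.

(** Otherwise each successor exceeds [mincost s] after some number of iterations; since the
    successors are finitely many, one number serves them all, and [valit] exceeds its own limit. *)
Lemma mincost_controlled s : controlled s -> mincost s < 1 ->
  exists2 t, trans s t & c s t + mincost t <= mincost s.
Proof.
move=> cs s1; apply: contrapT => /forall2NP h.
have /choice[k kP] : forall t, exists n,
    trans s t -> mincost s < c s t + valit n t.
  move=> t; case: (h t) => [nt|]; first by exists 0%N.
  move=> /negP; rewrite -ltNge -ltrBlDl => lt.
  apply: contrapT => /forallNP hn; move: lt; rewrite ltNge => /negP; apply.
  apply: mincost_le => n; rewrite leNgt; apply/negP => lt.
  by apply: (hn n) => _; rewrite -ltrBlDl.
pose N := \max_(t <- succs s) k t.
have : mincost s < valit N.+1 s.
  rewrite /= /bellman cs big_seq; apply: lt_bigmin => // t; rewrite mem_succs => st.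
  apply: lt_le_trans (kP t st) _; rewrite lerD2l valit_nondecreasing//.
  by rewrite leq_bigmax_seq// mem_succs.
by rewrite ltNge valit_le_mincost.
Qed.

(** * Costs of paths and of strategies that may give up *)

Definition path_cost (s : M) (p : seq M) : R :=
  \sum_(i < size p) c (nth s (s :: p) i) (nth s p i).

Lemma path_cost_rcons s p t :
  path_cost s (rcons p t) = path_cost s p + c (last s p) t.
Proof.
rewrite /path_cost size_rcons big_ord_recr/= nth_rcons ltnn eqxx.
congr (_ + c _ _); last by rewrite -rcons_cons nth_rcons/= ltnSn -last_nth.
apply: eq_bigr => i _; rewrite nth_rcons ltn_ord -rcons_cons nth_rcons/=.
by rewrite ltnS ltnW ?ltn_ord.
Qed.

Lemma nth_prefix_of (s x : M) (r : run s) n i : (i < n)%N ->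
  nth x (prefix_of r n) i = r i.+1.
Proof. by move=> lt; rewrite nth_mkseq. Qed.

Lemma nth_cons_prefix_of (s x : M) (r : run s) n i : (i < n)%N ->
  nth x (s :: prefix_of r n) i = r i.
Proof.
by case: i => [|i] lt /=; [rewrite visit0|rewrite nth_prefix_of// ltnW].
Qed.

Lemma path_cost_prefix_of s (r : run s) n :
  path_cost s (prefix_of r n) = \sum_(0 <= i < n) c (r i) (r i.+1).
Proof.
rewrite /path_cost size_mkseq big_mkord; apply: eq_bigr => i _.
by rewrite nth_prefix_of// nth_cons_prefix_of.
Qed.

Lemma path_cost_ge0 s p : 0 <= path_cost s p.
Proof. by rewrite sumr_ge0. Qed.

(* [D] is the set of histories after which to give up; [eta] is counted twice
   because the step that enters [D] has been paid for as well. *)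
Lemma valit_le_stop (sigma : strategy M) s (D : pred (seq M)) (eta : R) n :
  (forall p t, D p -> D (rcons p t)) ->
  (forall p, ~~ D p -> path_cost s p <= eta) ->
  (forall x y, c x y <= eta) ->
  valit n s <= 2 * eta + expect sigma s n (fun p => (D p)%:R).
Proof.
move=> Dr De ce; have eta0 : 0 <= eta by exact: le_trans (c_ge0 s s) (ce s s).
(* The cost paid plus the least cost to come in [m] steps, frozen once [D] holds at a bound for it:
   [eta] before the step entering [D], [eta] for that step, and [1] for giving up. *)
pose X m p := if D p then 1 + 2 * eta else path_cost s p + valit m (last s p).
have X0 : valit n s <= X n [::].
  rewrite /X /path_cost big_ord0 add0r; case: ifPn => // _.
  by have := valit_le1 n s; lra.
have /(le_trans X0) : X n [::] <= expect sigma s n (X 0%N).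
  apply: expect_submartingale => m p sp; have dp := stepP sigma sp.
  have [d0 _ _] := dp; rewrite {1}/X; case: ifPn => [Dp|nDp].
    rewrite -[leLHS](sum_distr_cst _ dp) ler_sum// => t _.
    by rewrite /X Dr ?lexx.
  have := valitS_le_step sigma m sp.
  rewrite -(lerD2l (path_cost s p)) => /le_trans; apply.
  rewrite -[path_cost s p](sum_distr_cst _ dp) -big_split ler_sum// => t _ /=.
  rewrite -mulrDr ler_wpM2l// /X last_rcons path_cost_rcons addrA.
  case: ifPn => // _; have := De _ nDp; have := ce (last s p) t.
  by have := valit_le1 m t; lra.
move/le_trans; apply.
rewrite -[2 * eta](expect_cst sigma s n) -expectD; apply: ler_expect => p _ _.
by rewrite /X /=; case: ifPn => [_|/De]/=; lra.
Qed.

(** * The MD strategy of minimizing moves and its guarantee *)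

Lemma optimal_policy : exists f : M -> M, forall s, trans s (f s) /\
  (controlled s -> mincost s < 1 -> c s (f s) + mincost (f s) <= mincost s).
Proof.
suff /choice[f fP] : forall s, exists t, trans s t /\
    (controlled s -> mincost s < 1 -> c s t + mincost t <= mincost s).
  by exists f.
move=> s; have [[cs s1]|h] := pselect (controlled s /\ mincost s < 1).
  by have [t st le] := mincost_controlled cs s1; exists t.
by have [t st] := trans_total s; exists t; split => // cs s1; case: h.
Qed.

Lemma policy_distr (f : M -> M) s : trans s (f s) ->
  is_distr (Succ s) (fun u => (u == f s)%:R : R).
Proof.
move=> sf; split => [t|t st|]; first exact: ler0n.
  by case: eqP st => // ->.
rewrite esum_fset// fsbig_finite//= -/(succs s) (bigD1_seq (f s))/=; last first.
- exact: succs_uniq.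
- by rewrite mem_succs.
by rewrite eqxx big1 ?adde0// => t /negPf->.
Qed.

Lemma optimal_strategy : exists tau : strategy M,
  [/\ memoryless tau, deterministic tau & forall s p,
   path (@trans _ M) s p -> mincost (last s p) < 1 ->
   \sum_(t <- succs (last s p)) step tau s p t * (c (last s p) t + mincost t)
     <= mincost (last s p)].
Proof.
have [f fP] := optimal_policy.
have tauP x p : is_history x p -> is_distr (Succ (last x p))
    (fun u => (u == f (last x p))%:R : R).
  by move=> _; apply: policy_distr; have [] := fP (last x p).
exists (Strategy tauP); split.
- by move=> x p y q _ _ /= ->.
- by move=> x p _; exists (f (last x p)).
- move=> s p sp; set x := last s p; move=> x1; rewrite /step/= -/x.
  case: ifPn => cx; last exact: mincost_random.
  have [xf /(_ cx x1) le] := fP x.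
  rewrite (bigD1_seq (f x)) ?mem_succs ?succs_uniq//= eqxx mul1r.
  by rewrite big1 ?addr0// => t /negPf->; rewrite mul0r.
Qed.

(** This is Ville's maximal inequality for [Y], cost paid plus [mincost]: starting from [mincost s],
    it reaches [1] with at most that probability. *)
Lemma optimal_strategy_prob (tau : strategy M) s (phi : set (run_space s)) :
  (forall p, path (@trans _ M) s p -> mincost (last s p) < 1 ->
   \sum_(t <- succs (last s p)) step tau s p t * (c (last s p) t + mincost t)
     <= mincost (last s p)) ->
  measurable phi ->
  [set r : run s | forall n, \sum_(0 <= i < n) c (r i) (r i.+1) < 1]
    `<=` phi ->
  ((1 - mincost s)%:E <= run_prob tau s phi)%E.
Proof.
move=> tauP mphi sub.
pose Y p := path_cost s p + mincost (last s p).
(* All prefixes of [p] are inspected, [p] included, so [D] persists as the history grows. *)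
pose D p := has (fun k => 1 <= Y (take k p)) (iota 0 (size p).+1).
have D_rcons p t : D (rcons p t) = D p || (1 <= Y (rcons p t)).
  rewrite /D size_rcons -[(size p).+2]addn1 iotaD has_cat add0n has_seq1.
  rewrite take_oversize ?size_rcons//; congr (_ || _).
  apply: eq_in_has => k; rewrite mem_iota ltnS => /andP[_ kp].
  by rewrite -cats1 takel_cat.
have nDY p : ~~ D p -> Y p < 1.
  apply: contraNT; rewrite -leNgt => Yp; apply/hasP; exists (size p).
    by rewrite mem_iota/=.
  by rewrite take_size.
(* [Y] is stopped on reaching [1] and cut down to [1] there; the cut only lowers the mean, so the
   supermartingale inequality survives. *)
pose Z p := if D p then 1 else Y p.
have Z0 : Z [::] <= mincost s.
  rewrite /Z /D /Y/= /path_cost big_ord0 add0r orbF.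
  by case: ifP.
have EZ n : expect tau s n Z <= mincost s.
  apply: le_trans Z0; apply: expect_supermartingale => p sp.
  have dp := stepP tau sp; have [d0 _ _] := dp; rewrite [leRHS]/Z.
  case: ifPn => [Dp|nDp].
    rewrite -[leRHS](sum_distr_cst _ dp) ler_sum// => t _.
    by rewrite /Z D_rcons Dp lexx.
  (* Nonnegative costs keep [mincost] below [1] outside [D], which is where [tauP] applies. *)
  have p1 : mincost (last s p) < 1.
    by apply: le_lt_trans (nDY _ nDp); rewrite lerDr path_cost_ge0.
  apply: (@le_trans _ _ (path_cost s p + \sum_(t <- succs (last s p))
      step tau s p t * (c (last s p) t + mincost t))); last first.
    by rewrite lerD2l tauP.
  rewrite -[path_cost s p](sum_distr_cst _ dp) -big_split.
  apply: ler_sum => t _ /=; rewrite -mulrDr ler_wpM2l//.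
  have -> : path_cost s p + (c (last s p) t + mincost t) = Y (rcons p t).
    by rewrite /Y path_cost_rcons last_rcons addrA.
  by rewrite /Z D_rcons (negbTE nDp)/=; case: ifP.
pose F n : set (run_space s) := [set r | D (prefix_of r n)].
have mF n : measurable (F n) by exact: measurable_prefix.
have mUF : measurable (\bigcup_n F n) by exact: bigcupT_measurable.
have FZ n : (run_prob tau s (F n) <= (mincost s)%:E)%E.
  rewrite run_prob_prefix lee_fin (le_trans _ (EZ n))// ler_expect// => p _ _.
  rewrite /Z; case: (D p) => //; rewrite addr_ge0 ?path_cost_ge0//.
  exact: mincost_ge0.
(* The events increase with [n], so the bound passes to their union by continuity from below. *)
have UF : (run_prob tau s (\bigcup_n F n) <= (mincost s)%:E)%E.
  have nd : nondecreasing_seq F.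
    apply/nondecreasing_seqP => n; apply/subsetPset => r /=.
    by rewrite /F/= prefix_ofS D_rcons => ->.
  have h := nondecreasing_cvg_mu (mu := run_prob tau s) mF mUF nd.
  rewrite -(cvg_lim _ h)//; apply: lime_le; first exact: cvgP h.
  exact: nearW.
have /le_trans : ((1 - mincost s)%:E <= run_prob tau s (~` (\bigcup_n F n)))%E.
  by rewrite probability_setC// EFinB leeB.
apply; apply: le_measure; rewrite ?inE//; first exact: measurableC.
apply: subset_trans sub => r nF n; rewrite -path_cost_prefix_of.
have : ~~ D (prefix_of r n) by apply/negP => Dr; apply: nF; exists n.
by move/nDY; apply: le_lt_trans; rewrite lerDl mincost_ge0.
Qed.

End ValueIteration.

(** * Measurability of the objective, and late exits from a set of edges *)

Section Prefixes.
Variables (sigma : strategy M) (s : M).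

Lemma measurable_edge (B : set (M * M)) n :
  measurable ([set r | B (edge r n)] : set (run_space s)).
Proof.
(* Edge [n] is determined by the first [n.+1] steps; prefixes omit the first state, hence
   [s :: p]. *)
pose Q p := `[< B (nth s (s :: p) n, nth s p n) >].
rewrite (_ : mkset _ = [set r | Q (prefix_of r n.+1)]).
  exact: measurable_prefix.
apply/seteqP; split => r /=; rewrite /Q asboolE nth_prefix_of//;
  by rewrite (@nth_cons_prefix_of _ _ _ n.+1).
Qed.

Definition leaves (B : set (M * M)) (n : nat) : set (run_space s) :=
  [set r | exists2 t, (n <= t)%N & ~ B (edge r t)].

Lemma measurable_leaves (B : set (M * M)) n : measurable (leaves B n).
Proof.
rewrite (_ : leaves B n =
    \bigcup_(t in [set t | (n <= t)%N]) [set r | (~` B) (edge r t)]).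
  by apply: bigcup_measurable => t _; exact: measurable_edge.
by apply/seteqP; split => r [t nt Bt]; exists t.
Qed.

Lemma FGE (B : set (M * M)) : FG s B = ~` \bigcap_n leaves B n.
Proof.
apply/seteqP; split => r.
  by move=> [N _ FN] h; have [t Nt] := h N I; apply; exact: FN.
move=> h; apply: contrapT => nFG; apply: h => n _; apply: contrapT => nl.
apply: nFG; exists n => // t nt; apply: contrapT => nB; apply: nl.
by exists t.
Qed.

Lemma measurable_FG (B : set (M * M)) : measurable (FG s B : set (run_space s)).
Proof.
rewrite FGE; apply: measurableC; apply: bigcap_measurable => // n _.
exact: measurable_leaves.
Qed.

(** Continuity from above: the events decrease to the empty set, as a run in [FG s B] takes only
    finitely many edges outside [B]. *)
Lemma leaves_small (phi : set (run_space s)) (B : set (M * M)) (e : R) :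
  measurable phi -> phi `<=` FG s B -> 0 < e ->
  exists n, (run_prob sigma s (phi `&` leaves B n) <= e%:E)%E.
Proof.
move=> mphi phiB e0; pose F n := phi `&` leaves B n.
have mF n : measurable (F n) by apply: measurableI => //; exact: measurable_leaves.
have F0 : \bigcap_n F n = set0.
  apply/seteqP; split => // r Fr; have [/phiB + _] := Fr 0%N I.
  by rewrite FGE; apply => n _; have [] := Fr n I.
have ni : nonincreasing_seq F.
  apply/nonincreasing_seqP => n; apply/subsetPset => r [pr [t nt Bt]].
  by split => //; exists t => //; exact: ltnW.
have h : (run_prob sigma s \o F) n @[n --> \oo] --> run_prob sigma s (\bigcap_n F n).
  apply: nonincreasing_cvg_mu => //.
    by rewrite (le_lt_trans (probability_le1 _ _))// ltry.
  by rewrite F0.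
apply: contrapT => /forallNP lt.
suff : (e%:E <= 0)%E by rewrite lee_fin leNgt e0.
rewrite F0 measure0 in h; rewrite -(cvg_lim _ h)//; apply: lime_ge.
  exact: cvgP h.
by apply: nearW => n; rewrite ltW// ltNge; exact/negP/lt.
Qed.

End Prefixes.
Arguments leaves s B n : clear implicits.

(** * Edge costs that encode the objective *)

Lemma sum_halves (eta : R) n : 0 <= eta ->
  \sum_(i < n) eta / 2 ^+ i.+1 <= eta.
Proof.
move=> eta0; suff -> : \sum_(i < n) eta / 2 ^+ i.+1 = eta - eta / 2 ^+ n.
  by rewrite gerBl divr_ge0// exprn_ge0.
elim: n => [|n IH]; first by rewrite big_ord0 expr0 divr1 subrr.
rewrite big_ord_recr/= IH exprS invfM; lra.
Qed.

(** Bounded sums of nonnegative costs converge, so the costs tend to [0]; once they are below [w],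
    the edges lie in [B]. *)
Lemma FG_bounded_cost (c : M -> M -> R) s (r : run s) (B : set (M * M)) (w : R) :
  (forall x y, 0 <= c x y) -> (forall x y, ~ B (x, y) -> w <= c x y) -> 0 < w ->
  (forall n, \sum_(0 <= i < n) c (r i) (r i.+1) < 1) -> FG s B r.
Proof.
move=> c0 cw w0 r1; pose u i := c (r i) (r i.+1).
have : cvgn (series u).
  apply: nondecreasing_is_cvgn.
    by apply: nondecreasing_series => i _ _; exact: c0.
  by exists 1 => _ [n _ <-]; exact/ltW/r1.
move=> /cvg_series_cvg_0/cvgrPdist_lt/(_ _ w0); apply: filterS => n.
rewrite sub0r normrN ger0_norm; last exact: c0.
by move=> un; apply: contrapT => /cw; rewrite leNgt un.
Qed.

(** Of the three [eta], two come from [valit_le_stop] and one from the runs in [phi] that miss some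
    time [k i]. *)
Lemma FG_strategy (sigma : strategy M) (s : M) (A : nat -> set (M * M)) (eta : R) :
  0 < eta -> exists tau : strategy M, [/\ memoryless tau, deterministic tau &
    (run_prob sigma s (\bigcap_i FG s (A i)) - (3 * eta)%:E <=
     run_prob tau s (\bigcap_i FG s (A i)))%E].
Proof.
move=> eta0; set phi : set (run_space s) := \bigcap_i FG s (A i).
have mphi : measurable phi.
  by apply: bigcap_measurable => // i _; exact: measurable_FG.
(* The bounds are summable with total [eta], which will control the union over [i]. *)
have /choice[k kP] : forall i, exists n,
    (run_prob sigma s (phi `&` leaves s (A i) n) <= (eta / (2 ^ i.+1)%:R)%:E)%E.
  move=> i; apply: leaves_small => //; first by move=> r; exact.
  by rewrite divr_gt0// ltr0n expn_gt0.
(* Partial sums make the exponents monotone while keeping [k i <= K i]. *)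
pose K i := (\sum_(j < i.+1) k j)%N.
have kK i : (k i <= K i)%N by rewrite /K big_ord_recr/= leq_addl.
have K_mono i j : (i <= j)%N -> (K i <= K j)%N.
  elim: j => [|j IH]; first by rewrite leqn0 => /eqP->.
  rewrite leq_eqVlt => /predU1P[->//|/IH h].
  by rewrite (leq_trans h)// /K [leqRHS]big_ord_recr/= leq_addr.
pose w i : R := eta / 2 ^+ K i.
have w0 i : 0 < w i by rewrite divr_gt0// exprn_gt0.
have w_anti m i : (m <= K i)%N -> w i <= eta / 2 ^+ m.
  by move=> mK; rewrite ler_pM2l// lef_pV2 ?posrE ?exprn_gt0// ler_eXn2l ?ltr1n.
have /choice[c cP] : forall e, exists x, (x = 0 /\ forall i, A i e) \/
    exists i, [/\ ~ A i e, forall j, ~ A j e -> (i <= j)%N & x = w i].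
  move=> e; have [[i Ai]|nA] := pselect (exists i, ~ A i e); last first.
    by exists 0; left; split => // i; apply: contrapT => Ai; apply: nA; exists i.
  have ex : exists i, `[< ~ A i e >] by exists i; apply/asboolP.
  case: (ex_minnP ex) => m /asboolP Am mmin.
  by exists (w m); right; exists m; split => // j Aj; apply: mmin; apply/asboolP.
have c_ge0 x y : 0 <= c (x, y).
  by case: (cP (x, y)) => [[-> _]//|[i [_ _ ->]]]; exact: ltW.
have c_le x y : c (x, y) <= eta.
  case: (cP (x, y)) => [[-> _]|[i [_ _ ->]]]; first exact: ltW.
  by have := @w_anti 0%N i isT; rewrite expr0 divr1.
(* The first index [j] with [e] outside [A j] is at most [i], and the weights do not increase with
   the index. *)
have c_ge i e : ~ A i e -> w i <= c e.
  move=> nA; case: (cP e) => [[_ /(_ i)]//|[j [_ jmin ->]]].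
  by apply: w_anti; apply: K_mono; exact: jmin.
pose d x y := c (x, y).
pose D (p : seq M) := `[< exists i t, [/\ (t < size p)%N, (k i <= t)%N &
  ~ A i (nth s (s :: p) t, nth s p t)] >].
have D_rcons p t : D p -> D (rcons p t).
  move=> /asboolP[i [n [np kn An]]]; apply/asboolP; exists i, n; split => //.
    by rewrite size_rcons ltnW.
  by rewrite -rcons_cons !nth_rcons np/= ltnS ltnW.
(* Outside [D], an edge taken at time [t] with first failing index [i] has [t < k i <= K i], hence
   costs at most [eta / 2 ^+ t.+1]; these bounds sum to at most [eta]. *)
have D_cost p : ~~ D p -> path_cost d s p <= eta.
  move=> /asboolPn nD; apply: le_trans (sum_halves (size p) (ltW eta0)).
  apply: ler_sum => t _; rewrite /d; set e := (_, _).
  case: (cP e) => [[-> _]|[i [nA _ ->]]].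
    by rewrite divr_ge0 ?ltW// exprn_gt0.
  apply: w_anti; apply: leq_trans (kK i); rewrite ltnNge; apply/negP => kt.
  by apply: nD; exists i, t.
pose bad := \bigcup_i (phi `&` leaves s (A i) (k i)).
have mbadi i : measurable (phi `&` leaves s (A i) (k i)).
  by apply: measurableI => //; exact: measurable_leaves.
have mbad : measurable bad by exact: bigcupT_measurable.
have bad_small : (run_prob sigma s bad <= eta%:E)%E.
  apply: le_trans (epsilon_trick0 xpredT (ltW eta0)).
  apply: (@le_trans _ _
    (\sum_(0 <= i <oo) run_prob sigma s (phi `&` leaves s (A i) (k i)))%E).
    exact: measure_sigma_subadditive.
  by apply: lee_nneseries => // i _; exact: kP.
have value_le : mincost d s <= 3 * eta + 1 - fine (run_prob sigma s phi).
  have fP : run_prob sigma s phi \is a fin_num by exact: fin_num_measure.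
  apply: (mincost_le c_ge0) => n.
  apply: le_trans (valit_le_stop c_ge0 sigma n D_rcons D_cost c_le) _.
  suff : ((expect sigma s n (fun p => (D p)%:R))%:E <=
      (1 - fine (run_prob sigma s phi) + eta)%:E)%E by rewrite lee_fin; lra.
  rewrite -run_prob_prefix EFinD EFinB fineK//.
  rewrite -probability_setC//.
  (* A run with a prefix in [D] is outside [phi], or it is in [phi] and misses some [k i], which
     puts it in [bad]. *)
  apply: (@le_trans _ _ (run_prob sigma s (~` phi `|` bad))); last first.
    apply: le_trans (measureU2 _ _ _) _ => //; first exact: measurableC.
    by rewrite leeD2l.
  apply: le_measure; rewrite ?inE.
  - exact: measurable_prefix.
  - by apply: measurableU => //; exact: measurableC.
  - move=> r /asboolP[i [t []]]; rewrite size_mkseq => tn kt nA.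
    have [pr|npr] := pselect (phi r); [right|by left].
    exists i => //; split => //; exists t => //.
    by move: nA; rewrite nth_prefix_of// nth_cons_prefix_of.
have [tau [tauM tauD tauP]] := optimal_strategy c_ge0.
exists tau; split => //.
have sub : [set r : run s | forall n, \sum_(0 <= i < n) d (r i) (r i.+1) < 1]
    `<=` phi.
  move=> r r1 i _; apply: (FG_bounded_cost c_ge0 _ (w0 i) r1) => x y.
  exact: c_ge.
apply: le_trans (optimal_strategy_prob c_ge0 (tauP s) mphi sub).
rewrite -[X in (X - _)%E]fineK; last exact: fin_num_measure.
by rewrite -EFinB lee_fin; lra.
Qed.

End FiniteBranching.

Theorem theorem30 (R : realType) (M : mdp R) (s0 : M)
    (A : nat -> set (M * M)) :
  finitely_branching M ->
  (forall i, (A i `<=` transitions M)%classic) ->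
  (forall i j, (i <= j)%N -> (A j `<=` A i)%classic) ->
  forall eps : R, (0 < eps)%R ->
  exists sigma : strategy M,
    memoryless sigma /\ deterministic sigma /\
    eps_optimal (\bigcap_i FG s0 (A i))%classic eps sigma.
Proof.
move=> fb _ _ eps eps0; set phi := \bigcap_i FG s0 (A i).
have mphi : measurable (phi : set (run_space s0)).
  by apply: bigcap_measurable => // i _; exact: measurable_FG.
(* Any strategy serves here: it witnesses that the value is nonnegative, hence finite. *)
have [sigma0 _] := optimal_strategy fb (c := fun _ _ => 0) (fun _ _ => lexx (0 : R)).
have fv : value phi \is a fin_num.
  rewrite ge0_fin_numE.
    apply: (@le_lt_trans _ _ 1%E); last exact: ltry.
    apply: ge_ereal_sup => _ [sigma _ <-]; exact: probability_le1 mphi.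
  apply: le_trans (measure_ge0 (run_prob sigma0 s0) phi) _.
  by apply: ereal_sup_ubound; exists sigma0.
(* One quarter is lost in choosing [sigma] near the supremum, three in [FG_strategy]. *)
have eps4 : 0 < eps / 4 by rewrite divr_gt0.
have [_ [sigma _ <-] lt] := ub_ereal_sup_adherent eps4 fv.
have [tau [tauM tauD tauP]] := FG_strategy fb sigma s0 A eps4.
exists tau; split => //; split => //; rewrite /eps_optimal.
apply: le_trans tauP; rewrite leeBrDr//.
apply: le_trans (ltW lt); rewrite -/(value phi) -(fineK fv) -!EFinB -EFinD lee_fin.
lra.
Qed.
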